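(* Let $G=(V,E)$ be a locally finite (unweighted) graph. For any neighboring vertices $x\sim y$, $$\kappa(x,y)\leq\frac{\sharp(x,y)}{d_x\vee d_y}.$$
   Context: Graphs $G=(V,E)$ are undirected, connected, simple, without loops; $V$ may be infinite; locally finite means every vertex has finitely many neighbors. $x\sim y$ means $x,y$ are neighbors, and $d_x$ is the degree (number of neighbors) of $x$. $d$ is the graph distance (number of edges of a shortest path). For each vertex $x$, $m_x$ is the probability measure on $V$ with $m_x(y)=1/d_x$ if $y\sim x$ and $m_x(y)=0$ otherwise. $W_1(\mu_1,\mu_2)=\inf_\xi\sum_{x',y'}d(x',y')\xi(x',y')$, the infimum over all probability measures $\xi$ on $V\times V$ with marginals $\mu_1$ and $\mu_2$. The Ollivier-Ricci curvature is $\kappa(x,y)=1-\frac{W_1(m_x,m_y)}{d(x,y)}$ for $x\neq y$. For $x\sim y$, $\sharp(x,y)$ is the number of triangles containing $x$ and $y$, i.e. the number of vertices $x_1$ with $x_1\sim x$ and $x_1\sim y$. $s\vee t=\max(s,t)$. *)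

(* Defs.v *)
From mathcomp Require Import all_boot all_order all_algebra finmap.
From mathcomp Require Import boolp classical_sets functions cardinality.
From mathcomp Require Import reals constructive_ereal ereal topology.
From mathcomp Require Import normedtype sequences esum.

Set Implicit Arguments.
Unset Strict Implicit.
Unset Printing Implicit Defensive.

Import Order.TTheory GRing.Theory Num.Theory.

Local Open Scope classical_set_scope.
Local Open Scope ring_scope.

Record graph (V : choiceType) := Graph {
  adj :> rel V;
  adj_sym : symmetric adj;
  adj_irrefl : irreflexive adj;
  adj_connected :
    forall x y : V, exists p : seq V, path adj x p && (last x p == y)
}.

Section GraphNotions.
Context {V : choiceType} (G : graph V).

Definition neighbors (x : V) : set V := [set y | G x y].

Definition locally_finite : Prop := forall x : V, finite_set (neighbors x).

(* [fset_set A] is [fset0] when [A] is infinite, so [deg] and [triangles] are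
   meaningful only under [locally_finite]. *)
Definition deg (x : V) : nat := #|` fset_set (neighbors x)|%fset.

Definition triangles (x y : V) : nat :=
  #|` fset_set (neighbors x `&` neighbors y)|%fset.

Definition joined_in (x y : V) (n : nat) : bool :=
  `[< exists p : seq V, [/\ path G x p, last x p = y & size p = n] >].

Lemma joined_in_ex (x y : V) : exists n : nat, joined_in x y n.
Proof.
have [p /andP[Gp /eqP py]] := adj_connected G x y.
by exists (size p); apply/asboolP; exists p.
Qed.

Definition gdist (x y : V) : nat := ex_minn (joined_in_ex x y).

End GraphNotions.

Section Curvature.
Context (R : realType) {V : choiceType} (G : graph V).

(* Measures on the discrete spaces [V] and [V * V] are given by their mass
   functions; a locally finite connected graph has countably many vertices. *)
Definition is_prob (T : choiceType) (mu : T -> R) : Prop :=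
  (forall t, 0 <= mu t) /\ \esum_(t in [set: T]) (mu t)%:E = 1%E.

Definition walk_measure (x y : V) : R :=
  if G x y then (deg G x)%:R^-1 else 0.

Definition coupling (mu1 mu2 : V -> R) (xi : V * V -> R) : Prop :=
  [/\ is_prob xi,
      forall x, \esum_(y in [set: V]) (xi (x, y))%:E = (mu1 x)%:E &
      forall y, \esum_(x in [set: V]) (xi (x, y))%:E = (mu2 y)%:E].

Definition transport_cost (xi : V * V -> R) : \bar R :=
  \esum_(p in [set: V * V]) ((gdist G p.1 p.2)%:R * xi p)%:E.

Definition W1 (mu1 mu2 : V -> R) : \bar R :=
  ereal_inf [set transport_cost xi | xi in coupling mu1 mu2].

(* Kept in [\bar R], like [W1], to avoid a default real value when no coupling
   has finite cost. *)
Definition kappa (x y : V) : \bar R :=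
  (1 - W1 (walk_measure x) (walk_measure y) * ((gdist G x y)%:R^-1)%:E)%E.

End Curvature.

(* Main.v *)
Require Import Defs.
From mathcomp Require Import all_boot all_order all_algebra finmap.
From mathcomp Require Import boolp classical_sets functions cardinality.
From mathcomp Require Import reals constructive_ereal ereal topology.
From mathcomp Require Import normedtype sequences esum.
From mathcomp Require Import fsbigop.

(** Transport between distinct vertices costs at least one per unit of mass, so
    only the mass that a coupling leaves on the diagonal travels for free.  At
    a vertex [z] that mass is bounded by each of the two marginals, hence by
    the smaller one: this gives
      W1 mu1 mu2 >= 1 - sum_z min (mu1 z) (mu2 z),
    which is [mass_le_cost_add_overlap] for an arbitrary coupling.

    For the walks from [x] and [y], the minimum at [z] vanishes unless [z] is a
    common neighbour, and is then the reciprocal of the larger degree.  The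
    overlap of the two measures is therefore the number of triangles divided by
    the larger degree ([overlap_walk_measure]).  Since adjacent vertices are at
    distance one, [kappa x y] is [1 - W1], and the bound follows. *)

Set Implicit Arguments.
Unset Strict Implicit.
Unset Printing Implicit Defensive.

Import Order.TTheory GRing.Theory Num.Theory.

Local Open Scope ring_scope.

Lemma gdist_gt0 (V : choiceType) (G : graph V) (x y : V) :
  x != y -> (0 < gdist G x y)%N.
Proof.
rewrite lt0n; apply: contra_neq => d0.
move: d0; rewrite /gdist; case: ex_minnP => n nP _ n0.
by move: nP; rewrite n0 => /asboolP[p [_ <- /size0nil ->]].
Qed.

Lemma gdist_adj (V : choiceType) (G : graph V) (x y : V) :
  G x y -> gdist G x y = 1%N.
Proof.
move=> xy; apply/eqP; rewrite eqn_leq gdist_gt0 ?andbT; last first.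
  by apply: contraTneq xy => ->; rewrite adj_irrefl.
rewrite /gdist; case: ex_minnP => n _; apply.
by apply/asboolP; exists [:: y]; rewrite /= xy.
Qed.

Local Open Scope ereal_scope.
Local Open Scope classical_set_scope.

Lemma le_esum_point (R : realType) (T : choiceType) (a : T -> \bar R) (t : T) :
  a t <= \esum_(u in [set: T]) a u.
Proof.
by apply: esum_ge; exists [set t]; rewrite ?fsbig_set1//; split.
Qed.

(** The free mass [xi (z, z)] is one term of the row sum [mu1 z] and of the
    column sum [mu2 z]; off the diagonal the cost dominates the mass. *)
Lemma mass_le_cost_add_overlap (R : realType) (V : choiceType) (G : graph V)
    (mu1 mu2 : V -> R) (xi : V * V -> R) :
  coupling mu1 mu2 xi ->
  1 <= transport_cost G xi
       + \esum_(z in [set: V]) (Num.min (mu1 z) (mu2 z))%:E.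
Proof.
case=> -[xi0 xi1] m1 m2; pose D : set (V * V) := range (fun z => (z, z)).
have xiE0 p : 0 <= (xi p)%:E by rewrite lee_fin.
have cost0 p : 0 <= ((gdist G p.1 p.2)%:R * xi p)%:E.
  by rewrite lee_fin mulr_ge0.
rewrite -xi1 (esumID D) // !setTI addeC leeD //.
  rewrite /transport_cost [leRHS](esumID D) // !setTI.
  apply: (@le_trans _ _ (\esum_(p in ~` D)
    ((gdist G p.1 p.2)%:R * xi p)%:E)); last by rewrite leeDr// esum_ge0.
  apply: le_esum => -[u v] nD; rewrite lee_fin ler_peMl// ler1n.
  by apply: gdist_gt0; apply/eqP => /= uv; apply: nD; exists u; rewrite ?uv.
rewrite esum_image; last by move=> u v _ _ [].
apply: le_esum => z _; rewrite lee_fin le_min -!lee_fin -m1 -m2.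
by rewrite (le_esum_point (fun u => (xi (z, u))%:E))
           (le_esum_point (fun u => (xi (u, z))%:E)).
Qed.

Lemma deg_gt0 (V : choiceType) (G : graph V) (x y : V) :
  locally_finite G -> G x y -> (0 < deg G x)%N.
Proof.
move=> lf xy; rewrite cardfs_gt0; apply/fset0Pn; exists y.
by rewrite in_fset_set ?inE//; exact: lf.
Qed.

Lemma in_neighbors (V : choiceType) (G : graph V) (x y : V) :
  (y \in neighbors G x) = G x y.
Proof. by apply/idP/idP; rewrite inE. Qed.

Lemma min_inv_pos (R : realFieldType) (a b : R) :
  (0 < a)%R -> (0 < b)%R -> (Num.min a^-1 b^-1 = (Num.max a b)^-1)%R.
Proof.
move=> a0 b0; case: (leP a b) => ab.
  by rewrite min_r// lef_pV2.
by rewrite min_l// lef_pV2// ltW.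
Qed.

(** On common neighbours of [x] and [y] both walks have positive mass, and the
    smaller one belongs to the larger degree; elsewhere one of them is zero. *)
Lemma overlap_walk_measure (R : realType) (V : choiceType) (G : graph V)
    (x y : V) : locally_finite G ->
  \esum_(z in [set: V]) (Num.min (walk_measure R G x z) (walk_measure R G y z))%:E
  = ((triangles G x y)%:R / Num.max (deg G x)%:R (deg G y)%:R)%:E.
Proof.
move=> lf; set c := (Num.max _ _)^-1%R.
pose T := neighbors G x `&` neighbors G y.
have c0 : (0 <= c)%R by rewrite invr_ge0 le_max ler0n.
have finT : finite_set T by apply: finite_setIl; exact: lf.
transitivity (\esum_(z in T) c%:E).
  rewrite [RHS]esum_mkcond; apply: eq_esum => z _.
  rewrite in_setI !in_neighbors /walk_measure.
  case xz: (G x z); case yz: (G y z) => //=.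
  - by rewrite min_inv_pos// ltr0n (deg_gt0 lf xz, deg_gt0 lf yz).
  - by rewrite min_r// invr_ge0.
  - by rewrite min_l// invr_ge0.
  - by rewrite minxx.
rewrite esum_fset// fsbig_finite//= sumEFin big_const_seq.
by rewrite count_predT iter_addr_0 mulr_natl.
Qed.

Local Close Scope classical_set_scope.
Local Close Scope ereal_scope.

Theorem theorem4 (R : realType) (V : choiceType) (G : graph V)
  (G_lf : locally_finite G) (x y : V) (xy : G x y) :
  (kappa R G x y
    <= ((triangles G x y)%:R / Num.max (deg G x)%:R (deg G y)%:R)%:E)%E.
Proof.
rewrite /kappa (gdist_adj xy) invr1 mule1.
rewrite lee_subel_addr// -leeBlDl//.
apply: le_ereal_inf_tmp => _ [xi cxi <-].
by rewrite leeBlDr// -overlap_walk_measure//; exact: mass_le_cost_add_overlap.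
Qed.
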